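(* Let $p>2$ be a prime, and define $\psi\in\mathbb{C}^{\{0,\ldots,p-1\}}$ by $$\psi(k)=e^{2\pi ik/3}+2e^{4\pi ik/3}$$ in the case $p=3$, and by $$\psi(k)=\delta_0(k)-p^{-1}-p^{-1}e^{2\pi ik/p}$$ for $p\ge 5$. Then the system $\pi_0(G)\psi=(\pi_0(k,l)\psi)_{(k,l)\in G}$ does matrix recovery on $\mathcal{H}_0$.
   Context: All arithmetic on indices in $\{0,1,\ldots,p-1\}$ is in the field $\mathbb{Z}_p=\mathbb{Z}/p\mathbb{Z}$, and $\mathbb{Z}_p^*=\mathbb{Z}_p\setminus\{0\}$ is the multiplicative group. $G=\mathbb{Z}_p\rtimes\mathbb{Z}_p^*$ is the affine group: the set $\mathbb{Z}_p\times\mathbb{Z}_p^*$ with group law $(k,l)(k',l')=(k+lk',ll')$. $\mathcal{H}_0=\{f\in\mathbb{C}^{\{0,\ldots,p-1\}}:\sum_{m=0}^{p-1}f(m)=0\}$ is the orthogonal complement of the constant vectors, and $\pi_0$ is the representation of $G$ on $\mathcal{H}_0$ given by $(\pi_0(k,l)f)(m)=f(l^{-1}(m-k))$. $\delta_0$ is the vector with $\delta_0(0)=1$ and zero entries elsewhere. A system $(\psi_i)_{i\in I}$ of vectors in a finite-dimensional complex Hilbert space $\mathcal{H}$ does matrix recovery if the linear map $A\mapsto(\langle A\psi_i,\psi_i\rangle)_{i\in I}$ from the space $\mathcal{L}(\mathcal{H})$ of linear maps $\mathcal{H}\to\mathcal{H}$ to $\mathbb{C}^I$ is one-to-one. *)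

(* Defs.v *)
From HB Require Import structures.
From mathcomp Require Import all_boot all_order all_algebra all_fingroup.
From mathcomp Require Import complex sesquilinear.
From mathcomp Require Import reals trigo ring.

Set Implicit Arguments.
Unset Strict Implicit.
Unset Printing Implicit Defensive.

Import Order.TTheory GRing.Theory Num.Theory Num.Def.
Local Open Scope ring_scope.

(* A finite-dimensional complex Hilbert space is a vectType [V] over [C]
   together with a positive definite Hermitian form, linear in its first
   argument. *)
Definition matrix_recovery (C : numClosedFieldType) (V : vectType C)
    (form : {dot V for conjC}) (I : Type) (psi : I -> V) : Prop :=
  injective (fun (A : 'End(V)) (i : I) => form (A (psi i)) (psi i)).

Definition affine (p : nat) : Type := ('F_p * {unit 'F_p})%type.

Section AffineGroup.
Variable p : nat.

HB.instance Definition _ := Finite.on (affine p).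

Definition affine_mul (x y : affine p) : affine p :=
  (x.1 + val x.2 * y.1, (x.2 * y.2)%g).
Definition affine_one : affine p := (0, 1%g).
Definition affine_inv (x : affine p) : affine p :=
  (- ((val x.2)^-1 * x.1), (x.2^-1)%g).

Fact affine_mulA : associative affine_mul.
Proof.
move=> [a b] [c d] [e f]; rewrite /affine_mul /=.
by rewrite mulgA mulrDr mulrA addrA.
Qed.
Fact affine_mul1g : left_id affine_one affine_mul.
Proof. by move=> [a b]; rewrite /affine_mul /= add0r mul1r mul1g. Qed.
Fact affine_mulVg : left_inverse affine_one affine_inv affine_mul.
Proof. by move=> [a b]; rewrite /affine_mul /affine_inv /= addNr mulVg. Qed.

HB.instance Definition _ :=
  Finite_isGroup.Build (affine p) affine_mulA affine_mul1g affine_mulVg.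

End AffineGroup.

Section H0.
Variables (C : numClosedFieldType) (p : nat).

(* The index set {0, ..., p-1} is 'F_p, whose elements coerce to nat. *)
Local Notation Cp := {ffun 'F_p -> C^o}.

Definition coord_sum (f : Cp) : C^o := \sum_(m : 'F_p) f m.

Fact coord_sum_is_linear : linear coord_sum.
Proof.
move=> a f g; rewrite /coord_sum scaler_sumr -big_split /=.
by apply: eq_bigr => m _; rewrite !ffunE.
Qed.
HB.instance Definition _ :=
  GRing.isLinear.Build C Cp C^o _ coord_sum coord_sum_is_linear.

Definition H0 : {vspace Cp} := lker (linfun coord_sum).

Lemma memH0 (f : Cp) : (f \in H0) = (\sum_(m : 'F_p) f m == 0).
Proof. by rewrite memv_ker lfunE. Qed.

Local Notation H0v := (subvs_of H0).

Definition H0dot (f g : H0v) : C :=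
  \sum_(m : 'F_p) (vsval f m : C) * (vsval g m : C)^*.

Fact H0dot_linearl (g : H0v) : linear_for *%R (H0dot^~ g).
Proof.
move=> a f h; rewrite /H0dot mulr_sumr -big_split /=.
by apply: eq_bigr => m _; rewrite !ffunE mulrDl mulrA.
Qed.
Fact H0dot_linearr (f : H0v) : linear_for (conjC \; *%R) (H0dot f).
Proof.
move=> a g h; rewrite /H0dot /= mulr_sumr -big_split /=.
apply: eq_bigr => m _.
by rewrite !ffunE rmorphD rmorphM mulrDr mulrCA.
Qed.
HB.instance Definition _ := bilinear_isBilinear.Build C H0v H0v C *%R
  (conjC \; *%R) H0dot (H0dot_linearl, H0dot_linearr).

Fact H0dot_hermitian (f g : H0v) : H0dot f g = (-1) ^+ false * (H0dot g f)^*.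
Proof.
rewrite mul1r rmorph_sum; apply: eq_bigr => m _.
by rewrite rmorphM /= conjCK mulrC.
Qed.
HB.instance Definition _ :=
  isHermitianSesquilinear.Build C H0v false conjC H0dot H0dot_hermitian.

Fact H0dot_gt0 (f : H0v) : f != 0 -> 0 < H0dot f f.
Proof.
move=> f0; rewrite lt_def sumr_ge0 ?andbT => [|m _]; last exact: mul_conjC_ge0.
apply: contra f0; rewrite psumr_eq0 => [/allP h|m _]; last exact: mul_conjC_ge0.
apply/eqP/val_inj/ffunP => m; rewrite ffunE.
by apply/eqP; rewrite -mul_conjC_eq0; exact: h (mem_index_enum m).
Qed.
HB.instance Definition _ := isDotProduct.Build C H0v H0dot H0dot_gt0.

Definition translate_dilate (x : affine p) (f : Cp) : Cp :=
  [ffun m => f ((val x.2)^-1 * (m - x.1))].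

Fact translate_dilate_H0 (x : affine p) (f : Cp) :
  f \in H0 -> translate_dilate x f \in H0.
Proof.
rewrite !memH0 => /eqP f0; rewrite -[X in _ == X]f0; apply/eqP.
rewrite [RHS](reindex (fun m => (val x.2)^-1 * (m - x.1))) /=.
  by apply: eq_bigr => m _; rewrite ffunE.
exists (fun m => val x.2 * m + x.1) => m _.
  by rewrite mulVKr ?subrK //; exact: valP.
by rewrite addrK mulKr //; exact: valP.
Qed.

Definition pi0 (x : affine p) (f : H0v) : H0v :=
  Subvs (translate_dilate_H0 x (subvsP f)).

Fact pi0_is_linear (x : affine p) : linear (pi0 x).
Proof. by move=> a f g; apply/val_inj/ffunP => m; rewrite !ffunE. Qed.
HB.instance Definition _ (x : affine p) :=
  GRing.isLinear.Build C H0v H0v _ (pi0 x) (pi0_is_linear x).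

Lemma pi01 : pi0 1%g =1 id.
Proof.
by move=> f; apply/val_inj/ffunP => m; rewrite ffunE /= invr1 mul1r subr0.
Qed.

Lemma pi0M (x y : affine p) : pi0 (x * y)%g =1 pi0 x \o pi0 y.
Proof.
move=> f; apply/val_inj/ffunP => m; rewrite !ffunE /=; congr (vsval f _).
rewrite invrM ?(valP x.2) ?(valP y.2) // -mulrA opprD addrA mulrBr.
by rewrite mulKr ?(valP x.2).
Qed.

End H0.

Section Psi.
Variables (R : realType) (p : nat).
Local Notation C := R[i].

(* [expi t] is e^(i t). *)
Definition expi (t : R) : C := Complex (cos t) (sin t).

Definition psi : {ffun 'F_p -> C^o} := [ffun k : 'F_p =>
  if p == 3%N then expi (2 * pi * k%:R / 3) + 2 * expi (4 * pi * k%:R / 3)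
  else (k == 0)%:R - p%:R^-1 - p%:R^-1 * expi (2 * pi * k%:R / p%:R)].

Lemma expiD (s t : R) : expi (s + t) = expi s * expi t.
Proof.
by rewrite /expi cosD sinD; congr Complex; rewrite [LHS]addrC addrC // addrC.
Qed.

Lemma expiMn (t : R) n : expi (t *+ n) = expi t ^+ n.
Proof.
elim: n => [|n IHn]; first by rewrite /expi cos0 sin0.
by rewrite mulrS expiD IHn exprS.
Qed.

Lemma sum_expr_unity_root (w : C) :
  prime p -> w ^+ p = 1 -> w != 1 -> \sum_(k : 'F_p) w ^+ k = 0.
Proof.
move=> p_pr wp w1; rewrite -(big_mkord xpredT (fun i => w ^+ i)) Fp_cast //.
rewrite big_mkord; apply: (mulfI (x := w - 1)); first by rewrite subr_eq0.
by rewrite -subrX1 wp subrr mulr0.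
Qed.

Section Membership.
Hypotheses (p_pr : prime p) (p_gt2 : (2 < p)%N).

Local Notation w := (expi (2 * pi / p%:R)).

Let p_neq0 : p%:R != 0 :> R.
Proof. by rewrite pnatr_eq0 -lt0n prime_gt0. Qed.

Lemma root_w : w ^+ p = 1.
Proof.
by rewrite -expiMn -[_ *+ p]mulr_natr mulfVK // mulrC mulr_natr /expi
  cos2pi sin2pi.
Qed.

Lemma w_neq1 : w != 1.
Proof.
have p_gt0 : 0 < p%:R :> R by rewrite ltr0n prime_gt0.
have : 0 < sin (2 * pi / p%:R : R).
  apply: sin_gt0_pi; rewrite divr_gt0 ?mulr_gt0 ?pi_gt0 //=.
  by rewrite ltr_pdivrMr // mulrC ltr_pM2l ?pi_gt0 // ltr_nat.
by rewrite lt_def => /andP[s0 _]; apply: contraNneq s0 => -[_ ->].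
Qed.

Lemma psi_H0 : psi \in H0 C p.
Proof.
have w0 : \sum_(k : 'F_p) w ^+ k = 0.
  by apply: sum_expr_unity_root; [|exact: root_w|exact: w_neq1].
have ek (k : 'F_p) : expi (2 * pi * k%:R / p%:R) = w ^+ k.
  by rewrite -expiMn -(mulr_natr (2 * pi / p%:R)) mulrAC.
rewrite memH0; under eq_bigr => k _ do rewrite ffunE.
have [p3|p_neq3] := eqVneq p 3%N.
  have q3 : p%:R = 3 :> R by rewrite p3.
  have w20 : \sum_(k : 'F_p) (w ^+ 2) ^+ k = 0.
    apply: sum_expr_unity_root => //; first by rewrite exprAC root_w expr1n.
    apply: contraNneq w_neq1 => w2.
    have : w ^+ 3 = 1 by rewrite -p3 root_w.
    by rewrite exprS w2 mulr1 => ->.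
  rewrite big_split -mulr_sumr /= -q3.
  rewrite (eq_bigr _ (fun k _ => ek k)) w0 add0r mulf_eq0; apply/orP; right.
  rewrite -[X in _ == X]w20; apply/eqP/eq_bigr => k _.
  rewrite -exprM -expiMn mulnC -(mulr_natr (2 * pi / p%:R)) natrM; congr expi.
  by rewrite q3; field.
rewrite !sumrB -mulr_sumr (eq_bigr _ (fun k _ => ek k)) w0 mulr0 subr0.
rewrite sumr_const card_Fp // -(mulr_natr p%:R^-1) mulVf; last first.
  by rewrite pnatr_eq0 -lt0n prime_gt0.
rewrite (bigD1 0) //= big1 => [|k /negbTE -> //].
by rewrite addr0 subrr.
Qed.
End Membership.
End Psi.

(* Main.v *)
Require Import Defs.
From mathcomp Require Import all_boot all_order all_algebra.
From mathcomp Require Import complex sesquilinear reals.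
From mathcomp Require Import trigo ring.

Set Implicit Arguments.
Unset Strict Implicit.
Unset Printing Implicit Defensive.

Import Order.TTheory GRing.Theory Num.Theory.
Local Open Scope ring_scope.

(** In the basis of nontrivial characters [e_n] of [Z_p], translations act
    diagonally and dilations permute the [e_n].  Averaging the recovery equations
    over translations therefore decouples the diagonals [m - n = d] of the matrix
    of [A].  For [p >= 5] all Fourier coefficients of [psi] on [Z_p^*] agree except
    for a zero at [1], so with [b] the [d]-th diagonal and [S] its sum the equations
    read [b j + b (j - d) = S] for [j != 0] ([b j = S] when [d = 0]); summing over
    [j] gives [(p - 3) S = 0] (resp. [(p - 2) S = 0]), hence [S = 0], and then
    [b = 0] follows by stepping along multiples of [d].  For [p = 3] the matrix is
    2 x 2 and the system is solved by hand. *)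

(** * Characters of [Z_p] and the decoupling of diagonals *)

Section FourierRecovery.
Variables (C : numClosedFieldType) (p : nat) (w : C).
Hypotheses (p_pr : prime p) (wp : w ^+ p = 1) (w_neq1 : w != 1).

Definition root_char (x : 'F_p) : C := w ^+ x.
Local Notation z := root_char.

Lemma root_charD (x y : 'F_p) : z (x + y) = z x * z y.
Proof.
have wq : w ^+ (Zp_trunc (pdiv p)).+2 = 1 by rewrite Fp_cast.
by rewrite /z /= -exprD expr_mod.
Qed.

Lemma root_char0 : z 0 = 1.
Proof. by []. Qed.

Lemma root_char_nat (n : nat) : z n%:R = w ^+ n.
Proof. by rewrite /z val_Fp_nat // expr_mod. Qed.

Lemma root_char_conj (x : 'F_p) : (z x)^* = z (- x).
Proof.
have wn : `|w| = 1.
  apply/eqP; rewrite -(@pexpr_eq1 _ _ p) ?prime_gt0 //.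
  by rewrite -normrX wp normr1.
have zn : z x * (z x)^* = 1 by rewrite -normCK /z normrX wn !expr1n.
have z1 : z x * z (- x) = 1 by rewrite -root_charD subrr root_char0.
by rewrite -[LHS]mulr1 -z1 mulrA [_ * z x]mulrC zn mul1r.
Qed.

(** A character trivial at [x] is trivial on all multiples of [x], in particular at [1], where its
    value is [w]. *)
Lemma root_char_neq1 (x : 'F_p) : x != 0 -> z x != 1.
Proof.
move=> x0; apply: contra w_neq1 => /eqP zx.
have zxn n : z (x *+ n) = 1.
  by elim: n => [|n IHn]; rewrite ?mulrS ?root_charD ?zx ?IHn ?mulr1 ?mulr0n.
have := zxn (x^-1 : 'F_p); rewrite -mulr_natr natr_Zp divff // => z1.
by rewrite -z1 -[1]/(1%:R) root_char_nat expr1.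
Qed.

(* Shifting [n] by 1 multiplies the sum by [z x]. *)
Lemma sum_root_char (x : 'F_p) : \sum_n z (n * x) = p%:R *+ (x == 0).
Proof.
have [->|x0] := eqVneq x 0.
  under eq_bigr => n _ do rewrite mulr0 root_char0.
  by rewrite sumr_const card_Fp.
apply/eqP; rewrite mulr0n -[_ == 0]orFb -(negbTE (root_char_neq1 x0)).
rewrite -subr_eq0 -mulf_eq0 mulrBl mul1r subr_eq0 mulr_sumr; apply/eqP.
rewrite [RHS](reindex_inj (addrI 1)); apply: eq_bigr => n _.
by rewrite -root_charD mulrDl mul1r.
Qed.

Let p_neq0 : p%:R != 0 :> C.
Proof. by rewrite pnatr_eq0 -lt0n prime_gt0. Qed.

(** Fourier inversion: pairing the transform with [z (- (d0 * k))] and summing over [k] isolates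
    [p * g d0] by orthogonality of characters. *)
Lemma fourier_inj (g : 'F_p -> C) :
  (forall k, \sum_d g d * z (d * k) = 0) -> forall d, g d = 0.
Proof.
move=> g0 d0.
have : \sum_k z (- (d0 * k)) * \sum_d g d * z (d * k) = 0.
  by rewrite big1 // => k _; rewrite g0 mulr0.
under eq_bigr => k _ do rewrite mulr_sumr.
rewrite exchange_big /=.
rewrite (eq_bigr (fun d => g d * (p%:R *+ (d - d0 == 0)))) => [|d _].
  rewrite (bigD1 d0) //= subrr eqxx big1 => [|d /negbTE dd0].
    by rewrite addr0 => /eqP; rewrite mulf_eq0 (negbTE p_neq0) orbF => /eqP.
  by rewrite subr_eq0 dd0 mulr0.
rewrite -sum_root_char mulr_sumr; apply: eq_bigr => k _.
by rewrite mulrCA -root_charD; congr (_ * z _); ring.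
Qed.

Local Notation H0v := (subvs_of (H0 C p)).

(* Includes the junk value [e_0 = 0], so that sums range over all of ['F_p]. *)
Definition fourier_fun (n : 'F_p) : {ffun 'F_p -> C^o} :=
  [ffun m => (n != 0)%:R * z (n * m)].

Fact fourier_fun_H0 (n : 'F_p) : fourier_fun n \in H0 C p.
Proof.
rewrite memH0; under eq_bigr => m _ do rewrite ffunE mulrC [n * _]mulrC.
by rewrite -mulr_suml sum_root_char; case: (n == 0); rewrite ?mulr0 ?mul0r.
Qed.

Definition fourier_vec (n : 'F_p) : H0v := Subvs (fourier_fun_H0 n).
Local Notation e := fourier_vec.

Lemma fourier_vec0 : e 0 = 0.
Proof. by apply/val_inj/ffunP => m; rewrite !ffunE eqxx mul0r. Qed.

Lemma sum_fourier_vecE (c : 'F_p -> C) (m : 'F_p) :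
  vsval (\sum_n c n *: e n) m =
    \sum_n c n * ((n != 0)%:R * z (n * m)) :> C.
Proof.
rewrite raddf_sum sum_ffunE; apply: eq_bigr => n _.
by rewrite /= !ffunE.
Qed.

Lemma pi0_fourier_vec (g : affine p) (n : 'F_p) :
  pi0 g (e n) = z (- (n / val g.2 * g.1)) *: e (n / val g.2).
Proof.
apply/val_inj/ffunP => m; rewrite !ffunE /=.
have u0 : val g.2 != 0 by rewrite -unitfE; exact: valP.
rewrite mulf_eq0 invr_eq0 (negbTE u0) orbF /GRing.scale /= [RHS]mulrCA.
by rewrite -root_charD; congr (_ * z _); ring.
Qed.

Lemma fourier_expansion (f : H0v) :
  f = \sum_n (p%:R^-1 * H0dot f (e n)) *: e n.
Proof.
apply/val_inj/ffunP => m; rewrite raddf_sum sum_ffunE /=.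
under eq_bigr => n _ do rewrite !ffunE /= /GRing.scale /= -mulrA.
rewrite -mulr_sumr; apply: (mulfI p_neq0); rewrite mulVKf //.
have -> : p%:R * vsval f m = \sum_n \sum_j vsval f j * z (n * (m - j)).
  rewrite exchange_big (bigD1 m) //= [X in _ + X]big1 => [|j jm].
    rewrite addr0 subrr; under eq_bigr => n _ do rewrite mulr0 root_char0.
    by rewrite sumr_const card_Fp // mulr1 mulr_natl.
  by rewrite -mulr_sumr sum_root_char subr_eq0 eq_sym (negbTE jm) mulr0.
(* The frequency [0] contributes the coordinate sum of [f], which vanishes on [H0]; this matches
   [e 0 = 0]. *)
apply: eq_bigr => n _; have [->|n0] := eqVneq n 0.
  have := subvsP f; rewrite memH0 => /eqP f0.
  rewrite mul0r mulr0 -[RHS]f0; apply: eq_bigr => j _.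
  by rewrite mul0r root_char0 mulr1.
rewrite mul1r /H0dot mulr_suml; apply: eq_bigr => j _.
rewrite ffunE n0 mul1r root_char_conj -mulrA -root_charD.
by congr (_ * z _); ring.
Qed.

(* [b n] is the entry of a matrix at the Fourier modes [n + d] and [n]. *)
Lemma matrix_recovery_diagonals (c : 'F_p -> C) :
  (forall (d : 'F_p) (b : 'F_p -> C), b 0 = 0 -> b (- d) = 0 ->
     (forall l, l != 0 -> \sum_n b n * (c (l * n) * (c (l * (n + d)))^*) = 0) ->
     forall n, b n = 0) ->
  matrix_recovery (@H0dot C p)
    (fun g : affine p => pi0 g (\sum_n c n *: e n)).
Proof.
move=> c_inj A B AB.
pose D := A - B.
have D0 (g : affine p) (v := pi0 g (\sum_n c n *: e n)) : H0dot (D v) v = 0.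
  rewrite /D lfunE /= lfunE /= linearBl /=.
  by move: (congr1 (@^~ g) AB); rewrite -/v /= => ->; rewrite subrr.
have De n m : H0dot (D (e n)) (e m) = 0.
  pose b d n := H0dot (D (e n)) (e (n + d)).
  have : b (m - n) n = 0.
    apply: (c_inj (m - n)) => [||l l0].
    - by rewrite /b fourier_vec0 linear0 linear0l.
    - by rewrite /b addNr fourier_vec0 linear0r.
    move: (m - n) => {n m} d; move: d.
    (* For fixed [l], the sums to be killed, as a function of [d], have as their transform at [k]
       the recovery equation for the group element [(k, l)]. *)
    apply: fourier_inj => k.
    have lu : l \is a GRing.unit by rewrite unitfE.
    pose u : {unit 'F_p} := FinRing.unit 'F_p lu.
    have vE : pi0 ((k, u) : affine p) (\sum_n c n *: e n) =
        \sum_n (c (l * n) * z (- (n * k))) *: e n.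
      rewrite raddf_sum (reindex_inj (mulfI l0)) /=.
      apply: eq_bigr => n _; rewrite linearZ /= pi0_fourier_vec /= scalerA.
      by have -> : l * n / l = n by rewrite mulrAC divff // mul1r.
    rewrite -[RHS](D0 (k, u)) vE.
    rewrite [X in H0dot X _]raddf_sum linear_sumlz /=.
    under eq_bigr do rewrite mulr_suml.
    rewrite exchange_big /=; apply: eq_bigr => n _.
    rewrite linearZ linearZl_LR /= linear_sumr /= mulr_sumr.
    rewrite [RHS](reindex_inj (addrI n)) /=; apply: eq_bigr => d _.
    rewrite linearZr_LR /= rmorphM /= root_char_conj opprK.
    have -> : d * k = (n + d) * k - n * k by ring.
    by rewrite root_charD /b; ring.
  by rewrite /b addrCA subrr addr0.
have DeE n : D (e n) = 0.
  rewrite [LHS]fourier_expansion big1 // => m _.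
  by rewrite De mulr0 scale0r.
apply/eqP; rewrite -subr_eq0; apply/eqP/lfunP => f.
rewrite [f]fourier_expansion raddf_sum lfunE /= big1 // => n _.
by rewrite linearZ /= -/D DeE scaler0.
Qed.

End FourierRecovery.

(** * Solving the linear system on each diagonal *)

Lemma sum_const_neq0 (C : numClosedFieldType) (p : nat) (s : C) :
  prime p -> \sum_(j : 'F_p | j != 0) s = (p%:R - 1) * s.
Proof.
move=> p_pr; apply: (addrI s).
have -> : s + (p%:R - 1) * s = \sum_(j : 'F_p) s.
  by rewrite sumr_const card_Fp // mulrBl mul1r mulr_natl addrC subrK.
by rewrite [RHS](bigD1 0).
Qed.

Lemma diagonals_recovery_ge5 (C : numClosedFieldType) (p : nat) :
  prime p -> (3 < p)%N -> forall (d : 'F_p) (b : 'F_p -> C),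
  b 0 = 0 -> b (- d) = 0 ->
  (forall j, j != 0 -> \sum_n b n * ((n != j) && (n + d != j))%:R = 0) ->
  forall n, b n = 0.
Proof.
move=> p_pr p_gt3 d b b0 bd bj.
pose S := \sum_n b n.
have SE : S = \sum_(j | j != 0) b j by rewrite /S (bigD1 0) //= b0 add0r.
have pick j : \sum_n b n * (n == j)%:R = b j.
  rewrite (bigD1 j) //= eqxx mulr1 big1 ?addr0 // => n /negbTE ->.
  by rewrite mulr0.
have p_neq k : (k <= 3)%N -> p%:R - k%:R != 0 :> C.
  by move=> k3; rewrite subr_eq0 eqr_nat gtn_eqF // (leq_ltn_trans k3).
have [d0|d0] := eqVneq d 0.
  have bS j : j != 0 -> b j = S.
    move=> j0; apply/esym/eqP; rewrite -subr_eq0 -[X in _ == X](bj j j0).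
    rewrite /S -{1}(pick j) -sumrB; apply/eqP/eq_bigr => n _.
    by rewrite d0 addr0 andbb; case: (n == j) => /=; ring.
  have S0 : S = 0.
    apply: (mulfI (p_neq 2%N isT)); rewrite mulr0.
    have : S = (p%:R - 1) * S.
      by rewrite -sum_const_neq0 // {1}SE; apply: eq_bigr => j /bS.
    by move=> SS; rewrite -[RHS](subrr S) {2}SS; ring.
  by move=> n; have [->|/bS ->] := eqVneq n 0.
(* As [d] is nonzero, the excluded indices [j] and [j - d] are distinct, so the equation is [S]
   minus these two entries. *)
have bS j : j != 0 -> b j + b (j - d) = S.
  move=> j0; apply/esym/eqP; rewrite -subr_eq0 -[X in _ == X](bj j j0).
  rewrite -{1}(pick j) -(pick (j - d)) -big_split -sumrB /=.
  apply/eqP/eq_bigr => n _.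
  rewrite -subr_eq opprK; have [->|nj] := eqVneq n j.
    by rewrite -[X in _ == X]addr0 (inj_eq (addrI j)) (negbTE d0) /=; ring.
  by case: (n + d == j) => /=; ring.
have S0 : S = 0.
  apply: (mulfI (p_neq 3%N isT)); rewrite mulr0.
  have : S + S = (p%:R - 1) * S.
    (* Both sums over nonzero [j] equal [S]: the omitted terms at [j = 0] are [b 0] and [b (- d)],
       both zero. *)
    rewrite -sum_const_neq0 // -(eq_bigr _ bS) big_split /= -SE; congr (_ + _).
    by rewrite {1}/S (reindex_inj (addIr (- d))) (bigD1 0) //= sub0r bd add0r.
  move=> SS; have -> : (p%:R - 3%:R) * S = (p%:R - 1) * S - (S + S) by ring.
  by rewrite -SS subrr.
(* The case [j = 0] is not among the equations; it comes from the two boundary zeros. *)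
have bd_step j : b j = - b (j - d).
  apply/eqP; rewrite -addr_eq0; have [->|/bS ->] := eqVneq j 0.
    by rewrite b0 sub0r bd addr0.
  by rewrite S0.
have bt t : b (d *+ t) = 0.
  elim: t => [|t IHt]; first by rewrite mulr0n.
  by rewrite bd_step mulrSr addrK IHt oppr0.
move=> n; have <- : d *+ (n / d : 'F_p) = n; last exact: bt.
by rewrite -mulr_natr natr_Zp mulrC divfK.
Qed.

Lemma sum_F3 (V : nmodType) (h : 'F_3 -> V) :
  \sum_(n : 'F_3) h n = h 0 + h 1 + h (1 + 1).
Proof.
rewrite -[LHS]/(\sum_(n < 3) h n) !big_ord_recl big_ord0 addr0 addrA.
by congr (h _ + h _ + h _); apply/val_inj.
Qed.

Lemma F3P (x : 'F_3) : [\/ x = 0, x = 1 | x = 1 + 1].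
Proof.
case: x => [[|[|[|m]]] hm]; last by [].
- by apply: Or31; apply/val_inj.
- by apply: Or32; apply/val_inj.
- by apply: Or33; apply/val_inj.
Qed.

(** For [d = 0], [l = 1] and [l = 2] give a system in [b 1], [b 2] with rows [(1, 4)] and [(4, 1)],
    of determinant [-15]. For [d != 0], the condition at [- d] leaves one unknown, and [l = 1] kills
    it. *)
Lemma diagonals_recovery_3 (C : numClosedFieldType) (d : 'F_3) (b : 'F_3 -> C)
    (c := fun n : 'F_3 => (n : nat)%:R : C) :
  b 0 = 0 -> b (- d) = 0 ->
  (forall l, l != 0 -> \sum_n b n * (c (l * n) * (c (l * (n + d)))^*) = 0) ->
  forall n, b n = 0.
Proof.
move=> b0 bd bl.
have := bl 1 isT; have := bl (1 + 1) isT; rewrite !sum_F3 b0 /c !rmorph_nat.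
have [dE|dE|dE] := F3P d; rewrite dE in bd *.
- move=> l2 l1.
  have {}l1 : b 1 * (1 * 1) + b (1 + 1) * (2%:R * 2%:R) = 0.
    by rewrite -[RHS]l1 mul0r add0r.
  have {}l2 : b 1 * (2%:R * 2%:R) + b (1 + 1) * (1 * 1) = 0.
    by rewrite -[RHS]l2 mul0r add0r.
  have n15 : 15%:R != 0 :> C by rewrite pnatr_eq0.
  have b1 : b 1 = 0.
    apply: (mulfI n15); rewrite mulr0.
    have -> : 15%:R * b 1 = 4%:R * (b 1 * (2%:R * 2%:R) + b (1 + 1) * (1 * 1))
        - (b 1 * (1 * 1) + b (1 + 1) * (2%:R * 2%:R)) by ring.
    by rewrite l1 l2 mulr0 subr0.
  have b2 : b (1 + 1) = 0.
    by rewrite -[RHS]l2 b1 mul0r add0r !mulr1.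
  by move=> n; have [->|->|->] := F3P n.
- have b2 : b (1 + 1) = 0 by rewrite -[RHS]bd; congr b; apply/val_inj.
  rewrite b2 => _ l1.
  have {}l1 : b 1 * (1 * 2%:R) = 0 by rewrite -[RHS]l1 !mul0r add0r addr0.
  have b1 : b 1 = 0.
    by apply/eqP; move/eqP: l1; rewrite mul1r mulf_eq0 pnatr_eq0 orbF.
  by move=> n; have [->|->|->] := F3P n.
- have b1 : b 1 = 0 by rewrite -[RHS]bd; congr b; apply/val_inj.
  rewrite b1 => _ l1.
  have {}l1 : b (1 + 1) * (2%:R * 1) = 0 by rewrite -[RHS]l1 !mul0r !add0r.
  have b2 : b (1 + 1) = 0.
    by apply/eqP; move/eqP: l1; rewrite mulr1 mulf_eq0 pnatr_eq0 orbF.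
  by move=> n; have [->|->|->] := F3P n.
Qed.

(** * Fourier coefficients of [psi] and conclusion *)

Section PsiExpansion.
Variables (R : realType) (p : nat).
Hypotheses (p_pr : prime p) (p_gt2 : (2 < p)%N).
Local Notation w := (expi (2 * pi / p%:R) : R[i]).
Local Notation z := (root_char w).
Local Notation e := (fourier_vec p_pr (root_w R p_pr) (w_neq1 R p_pr p_gt2)).

Lemma expi_root_char (k : 'F_p) : expi (2 * pi * k%:R / p%:R) = z k.
Proof. by rewrite /root_char -expiMn -(mulr_natr (2 * pi / p%:R)) mulrAC. Qed.

(** Since [p] times the delta at [0] is the sum of all characters, subtracting the two other terms
    of [psi] removes the frequencies [0] and [1]. The coefficient at [0] may stay [p^-1] because
    [e 0 = 0]. *)
Lemma psi_expansion_ge5 : p != 3%N ->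
  Subvs (psi_H0 R p_pr p_gt2) = \sum_n (p%:R^-1 * (n != 1)%:R) *: e n.
Proof.
move=> p3; apply/val_inj/ffunP => k; rewrite [RHS]sum_fourier_vecE /= ffunE.
rewrite (negbTE p3) expi_root_char.
have p_neq0 : p%:R != 0 :> R[i] by rewrite pnatr_eq0 -lt0n prime_gt0.
transitivity (p%:R^-1 * (\sum_n z (n * k) - 1 - z k)).
  rewrite (sum_root_char p_pr (root_w R p_pr) (w_neq1 R p_pr p_gt2)).
  by rewrite !mulrBr mulr1; case: (k == 0) => /=; field.
rewrite [X in X - 1](bigD1 0) //= (bigD1 1) ?oner_eq0 //= mul0r mul1r.
rewrite root_char0; set S := \sum_(i | _) _.
have -> : 1 + (z k + S) - 1 - z k = S by ring.
rewrite [RHS](bigD1 0) //= [X in _ = _ + X](bigD1 1) ?oner_eq0 //=.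
rewrite !(mul0r, mulr0, add0r) /S mulr_sumr.
apply: eq_bigr => n /andP[n0 n1].
by rewrite n0 n1 mulr1 mul1r.
Qed.

End PsiExpansion.

(** The two exponentials in [psi] are the characters of frequency [1] and [2], and their weights [1]
    and [2] coincide with the frequencies. *)
Lemma psi_expansion_3 (R : realType) (p_pr : prime 3) (p_gt2 : (2 < 3)%N) :
  Subvs (psi_H0 R p_pr p_gt2) = \sum_(n : 'F_3) ((n : nat)%:R) *:
    fourier_vec p_pr (root_w R p_pr) (w_neq1 R p_pr p_gt2) n.
Proof.
apply/val_inj/ffunP => k; rewrite [RHS]sum_fourier_vecE sum_F3 [LHS]ffunE /=.
rewrite !(mul0r, add0r, mul1r) -expi_root_char.
have -> : (1 + 1) * k = k + k by rewrite mulrDl mul1r.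
rewrite root_charD ?root_w // -expi_root_char -expiD.
by congr (_ + 2 * expi _); field.
Qed.

Theorem corollary6p10 (R : realType) (p : nat) (p_pr : prime p)
    (p_gt2 : (2 < p)%N) :
  matrix_recovery (@H0dot R[i] p)
    (fun g : affine p => pi0 g (Subvs (psi_H0 R p_pr p_gt2))).
Proof.
have [p3|p3] := eqVneq p 3%N.
  subst p; rewrite psi_expansion_3; apply: matrix_recovery_diagonals.
  exact: diagonals_recovery_3.
rewrite psi_expansion_ge5 //; apply: matrix_recovery_diagonals => d b b0 bd bl.
apply: (diagonals_recovery_ge5 p_pr _ b0 bd) => [|j j0].
  by rewrite ltn_neqAle eq_sym p3.
have p_neq0 : p%:R != 0 :> R[i] by rewrite pnatr_eq0 -lt0n prime_gt0.
have q0 : p%:R^-1 * p%:R^-1 != 0 :> R[i] by rewrite mulf_neq0 ?invr_eq0.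
(* Dilating with [l = j^-1] moves the missing frequency from [1] to [j]; the two coefficients share
   the factor [p^-1 * p^-1], which cancels. *)
apply: (mulfI q0); rewrite mulr0 -[RHS](bl j^-1) ?invr_eq0 // mulr_sumr.
have jn n : (j^-1 * n == 1) = (n == j).
  by rewrite -(inj_eq (mulfI j0)) mulVKf // mulr1.
apply: eq_bigr => n _; rewrite !jn rmorphM fmorphV !rmorph_nat -mulnb natrM.
by ring.
Qed.
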